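(* Let $p$ be an odd prime and $n\ge1$, and use the convention $Q_{n,t}:=0$ for $t<0$. (1) For $i=n+1$ and $0\le s<n$, $$\delta_{n+1}(Q_{n,s})=Q_{n,n-1}^{\,p}Q_{n,s}-Q_{n,s-1}^{\,p}.$$ For every integer $m\ge 1$, $$\delta_{n+1}^{\,m}(Q_{n,s})=Q_{n,n-1}^{\,mp}Q_{n,s}-Q_{n,n-1}^{\,(m-1)p}Q_{n,s-1}^{\,p}$$ and $$(\mathrm{St}^{\Delta_{n+1}})^{m}(Q_{n,s})=(-1)^{mn}\,m!\,Q_{n,0}^{\,m}\left(Q_{n,n-1}^{\,mp}Q_{n,s}-Q_{n,n-1}^{\,(m-1)p}Q_{n,s-1}^{\,p}\right).$$ (2) For $i=n+2$ and $0\le s<n$, set $$A^{(n+2)}_s:=Q_{n,s-2}^{\,p^2}-Q_{n,s-1}^{\,p}Q_{n,n-1}^{\,p^2},\qquad B^{(n+2)}:=Q_{n,n-1}^{\,p^2+p}-Q_{n,n-2}^{\,p^2};$$ equivalently, $A^{(n+2)}_s=\big(Q_{n,s-2}^{\,p}-Q_{n,s-1}Q_{n,n-1}^{\,p}\big)^p$ and $B^{(n+2)}=\big(Q_{n,n-1}^{\,p+1}-Q_{n,n-2}^{\,p}\big)^p$. Then $$\delta_{n+2}(Q_{n,s})=A^{(n+2)}_s+B^{(n+2)}Q_{n,s},$$ and, for every integer $m\ge 1$, $$\delta_{n+2}^{\,m}(Q_{n,s})=\big(B^{(n+2)}\big)^mQ_{n,s}+\big(B^{(n+2)}\big)^{m-1}A^{(n+2)}_s,$$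 while $$(\mathrm{St}^{\Delta_{n+2}})^{m}(Q_{n,s})=(-1)^{mn}\,m!\,Q_{n,0}^{\,m}\left(\big(B^{(n+2)}\big)^mQ_{n,s}+\big(B^{(n+2)}\big)^{m-1}A^{(n+2)}_s\right).$$ (3) For both $i=n+1$ and $i=n+2$, $(\mathrm{St}^{\Delta_i})^{m}(Q_{n,s})=0$ for all $m\ge p$ and $0\le s<n$.
   Context: Let $p$ be an odd prime, $n\ge 1$, and $P_n=\mathbb{F}_p[x_1,\dots,x_n]$. For integers $e_1,\dots,e_n\ge 0$ put $[e_1,\dots,e_n]:=\det\big(x_r^{p^{e_s}}\big)_{1\le r,s\le n}\in P_n$. Let $L_n=[0,1,\dots,n-1]$ and $L_{n,s}=[0,1,\dots,\widehat{s},\dots,n]$ for $0\le s<n$ (a hat means omission). The Dickson invariants are $Q_{n,s}=L_{n,s}/L_n$ $(0\le s<n)$; in particular $Q_{n,0}=L_n^{p-1}$. The Dickson algebra is $D_n=P_n^{\mathrm{GL}_n(\mathbb{F}_p)}=\mathbb{F}_p[Q_{n,0},\dots,Q_{n,n-1}]$, a polynomial algebra on these generators. For $i\ge1$, $\mathrm{St}^{\Delta_i}$ denotes the Steenrod--Milnor operation dual to the monomial $\xi_i$ in Milnor's dual mod-$p$ Steenrod algebra. It acts on $P_n$ as the unique $\mathbb{F}_p$-linear derivation with $\mathrm{St}^{\Delta_i}(x_r)=x_r^{p^i}$ $(1\le r\le n)$, and it maps $D_n$ into $D_n$. On a localization of $D_n$, $\mathrm{St}^{\Delta_i}$ means the unique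 derivation extending $\mathrm{St}^{\Delta_i}|_{D_n}$. The normalized derivation is $\delta_i:=(-1)^nQ_{n,0}^{-1}\mathrm{St}^{\Delta_i}$ on $D_n[Q_{n,0}^{-1}]$; it maps $D_n$ into $D_n$. Powers of operators denote iterated composition, and $m!$ is viewed in $\mathbb{F}_p$. *)

(* Defs.v *)
From HB Require Import structures.
From mathcomp Require Import all_boot all_order all_algebra.
From mathcomp Require Import perm mpoly ring.

Set Implicit Arguments.
Unset Strict Implicit.
Unset Printing Implicit Defensive.

Import GRing.Theory.
Local Open Scope ring_scope.

(* Additive and Leibniz on a subset S of a ring. When S is a subring that is  *)
(* an algebra over the prime field F_p, F_p-linearity is automatic.           *)
Definition derivation_on (R : nzRingType) (S : R -> Prop) (d : R -> R) : Prop :=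
  (forall x y, S x -> S y -> d (x + y) = d x + d y) /\
  (forall x y, S x -> S y -> d (x * y) = d x * y + x * d y).

(* Extension of a derivation to the field of fractions by the quotient rule   *)
(* (independence of the representative is frac_derE).                         *)
Definition frac_der (R : idomainType) (d : R -> R) (x : {fraction R}) :
    {fraction R} :=
  let a := \n_(repr x) in
  let b := \d_(repr x) in
  tofrac (d a * b - a * d b) / tofrac (b ^+ 2).

Definition moore (p n : nat) (e : 'I_n -> nat) : {mpoly 'F_p[n]} :=
  \det (\matrix_(r < n, s < n) ('X_r : {mpoly 'F_p[n]}) ^+ (p ^ e s)).

Section Dickson.
Variables (p n : nat).

Notation P := {mpoly 'F_p[n]}.

Definition Ln : P := moore p (fun k => k).

(* bump s enumerates 0, 1, ... with s omitted. *)
Definition Lns (s : nat) : P := moore p (fun k => bump s k).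

(* Dickson invariants, as elements of Frac(P_n); zero for negative indices,   *)
(* relevant for 0 <= t < n.                                                   *)
Definition dickson (t : int) : {fraction P} :=
  match t with
  | Posz s => tofrac (Lns s) / tofrac Ln
  | Negz _ => 0
  end.

Definition gl_act (g : 'M['F_p]_n) (f : P) : P :=
  f \mPo [tuple \sum_(k < n) g r k *: ('X_k : P) | r < n].

Definition dickson_alg (f : P) : Prop :=
  forall g : 'M['F_p]_n, g \in unitmx -> gl_act g f = f.

(* D_n[Q_{n,0}^-1] inside Frac(P_n). *)
Definition dickson_loc (x : {fraction P}) : Prop :=
  exists (f : P) (k : nat), dickson_alg f /\ x = tofrac f / dickson 0 ^+ k.

(* The derivation of P_n with x_r |-> x_r ^ (p ^ i); see StPP. *)
Definition StP (i : nat) (f : P) : P :=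
  \sum_(r < n) ('X_r : P) ^+ (p ^ i) * f^`M(r).

(* St^{Delta_i} on Frac(P_n). It stabilizes D_n[Q_{n,0}^-1] (St_loc) and is   *)
(* there the unique derivation extending St^{Delta_i} on D_n (St_locP).       *)
Definition St (i : nat) : {fraction P} -> {fraction P} := frac_der (StP i).

Definition delta (i : nat) (x : {fraction P}) : {fraction P} :=
  (-1) ^+ n * (dickson 0)^-1 * St i x.

End Dickson.

Section FracDer.
Variables (R : idomainType) (d : R -> R).
Hypothesis dD : {morph d : x y / x + y}.
Hypothesis dM : forall x y, d (x * y) = d x * y + x * d y.

Lemma fracP (x : {fraction R}) :
  exists a b, [/\ b != 0, x = tofrac a / tofrac b,
    a = \n_(repr x) & b = \d_(repr x)].
Proof.
exists \n_(repr x), \d_(repr x); have b0 := denom_ratioP (repr x).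
split=> //; apply: (@mulIf _ (tofrac \d_(repr x))); first by rewrite tofrac_eq0.
rewrite divfK ?tofrac_eq0 //.
rewrite -[X in X * _](@reprK _ {fraction R}).
rewrite !piE /=; apply/eqmodP => /=.
rewrite /FracField.equivf /FracField.mulf /= !numden_Ratio ?oner_eq0 ?mulr1 //.
by rewrite mulrC.
Qed.

Lemma frac_eqdiv (a b a' b' : R) : b != 0 -> b' != 0 ->
  tofrac a / tofrac b = tofrac a' / tofrac b' <-> a * b' = a' * b.
Proof.
move=> b0 b'0; have fb : tofrac b != 0 by rewrite tofrac_eq0.
have fb' : tofrac b' != 0 by rewrite tofrac_eq0.
split=> [/eqP|e].
  by rewrite eqr_div // -!tofracM tofrac_eq => /eqP.
by apply/eqP; rewrite eqr_div // -!tofracM tofrac_eq; apply/eqP.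
Qed.

Lemma frac_derE a b : b != 0 ->
  frac_der d (tofrac a / tofrac b) =
  tofrac (d a * b - a * d b) / tofrac (b ^+ 2).
Proof.
move=> b0; set x := _ / _.
have [a' [b' [b'0 e ea eb]]] := fracP x.
rewrite /frac_der -ea -eb; apply/frac_eqdiv; rewrite ?expf_neq0 //.
move: e; rewrite /x => /(frac_eqdiv _ _ b0 b'0) e.
have := congr1 d e; rewrite !dM => de.
have -> : (d a' * b' - a' * d b') * b ^+ 2 =
    (d a' * b + a' * d b) * (b' * b) - (a' * b) * (d b * b' + b * d b').
  by ring.
rewrite -de -e; ring.
Qed.

Lemma der1 : d 1 = 0.
Proof. by have /eqP := dM 1 1; rewrite !mul1r mulr1 -subr_eq subrr eq_sym => /eqP. Qed.

Lemma frac_der_tofrac a : frac_der d (tofrac a) = tofrac (d a).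
Proof.
have -> : tofrac a = tofrac a / tofrac 1 by rewrite tofrac1 divr1.
by rewrite frac_derE ?oner_neq0 // der1 mulr0 subr0 mulr1 expr1n tofrac1 divr1.
Qed.

Lemma frac_derP : derivation_on (fun _ => True) (frac_der d).
Proof.
split=> x y _ _; have [a [b [b0 -> _ _]]] := fracP x;
  have [a' [b' [b'0 -> _ _]]] := fracP y;
  have fb : tofrac b != 0 by rewrite tofrac_eq0.
- have fb' : tofrac b' != 0 by rewrite tofrac_eq0.
  rewrite addf_div // -!tofracM -tofracD.
  rewrite !frac_derE ?mulf_neq0 // addf_div ?tofrac_eq0 ?expf_neq0 //.
  rewrite -!tofracM -tofracD.
  apply/frac_eqdiv; rewrite ?expf_neq0 ?mulf_neq0 ?expf_neq0 //.
  by rewrite dD !dM; ring.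
- have fb' : tofrac b' != 0 by rewrite tofrac_eq0.
  rewrite mulf_div -!tofracM.
  rewrite !frac_derE ?mulf_neq0 // !mulf_div addf_div;
    rewrite -?tofracM ?tofrac_eq0 ?mulf_neq0 ?expf_neq0 //.
  rewrite -tofracD.
  apply/frac_eqdiv; rewrite ?expf_neq0 ?mulf_neq0 ?expf_neq0 //.
  by rewrite !dM; ring.
Qed.
End FracDer.

Section DicksonFacts.
Variables (p n : nat).
Hypothesis p_pr : prime p.

Local Notation P := {mpoly 'F_p[n]}.
Local Notation X r := ('X_r : P).

Let pcharP : p \in [pchar P].
Proof.
by rewrite inE p_pr -mpolyC_nat mpolyC_eq0; have := pchar_Fp p_pr; rewrite inE p_pr.
Qed.

Lemma frob_sum k (I : finType) (F : I -> P) :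
  (\sum_i F i) ^+ (p ^ k) = \sum_i F i ^+ (p ^ k).
Proof.
elim: k F => [|k IH] F; first by under [RHS]eq_bigr do rewrite expr1.
rewrite expnSr exprM IH -(pFrobenius_autE pcharP) rmorph_sum /=.
by apply: eq_bigr => i _; rewrite exprM.
Qed.

Lemma Fp_exp k (c : 'F_p) : c ^+ (p ^ k) = c.
Proof.
elim: k => [|k IH]; rewrite ?expr1 // expnSr exprM IH.
rewrite -[c]natr_Zp -(pFrobenius_autE (pchar_Fp p_pr)).
exact: pFrobenius_aut_nat.
Qed.

Lemma gl_actXU g (r : 'I_n) : gl_act g (X r) = \sum_k g r k *: X k.
Proof. by rewrite /gl_act comp_mpolyXU -tnth_nth tnth_mktuple. Qed.

Lemma gl_act_moore g (e : 'I_n -> nat) :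
  gl_act g (moore p e) = (\det g)%:MP * moore p e.
Proof.
rewrite !/moore /gl_act -!det_map_mx -det_mulmx; congr (\det _).
apply/matrixP => r s; rewrite !mxE rmorphXn /= -/(gl_act _ _) gl_actXU frob_sum.
by apply: eq_bigr => k _; rewrite !mxE exprZn Fp_exp mul_mpolyC.
Qed.

Lemma gl_act_Ln g : gl_act g (Ln p n) = (\det g)%:MP * Ln p n.
Proof. by rewrite /Ln gl_act_moore. Qed.

Lemma gl_act_Lns g s : gl_act g (Lns p n s) = (\det g)%:MP * Lns p n s.
Proof. by rewrite /Lns gl_act_moore. Qed.

Lemma gl_actM g (f h : P) : gl_act g (f * h) = gl_act g f * gl_act g h.
Proof. exact: rmorphM. Qed.

Lemma gl_actX g (f : P) k : gl_act g (f ^+ k) = gl_act g f ^+ k.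
Proof. exact: rmorphXn. Qed.

Lemma Ln_neq0 : Ln p n != 0.
Proof.
pose m (s : 'S_n) : 'X_{1..n} := [multinom (p ^ s r)%N | r < n].
have m_inj : injective m.
  move=> s t /mnmP e; apply/permP => r; apply: val_inj.
  by have := e r; rewrite !mnmE => /(expnI (prime_gt1 p_pr)).
have -> : Ln p n = \sum_(s : 'S_n) (-1) ^+ s *: 'X_[m s].
  rewrite /Ln /moore; apply: eq_bigr => s _; rewrite scaler_sign -signr_odd.
  have -> : \prod_i (\matrix_(r, s) X r ^+ (p ^ s)) i (s i) = 'X_[m s].
    by rewrite mpolyXE_id; apply: eq_bigr => i _; rewrite mxE mnmE.
  by case: (odd_perm s); rewrite ?mulN1r ?mul1r.
apply/eqP => /(congr1 (fun f : P => f@_(m (1%g : 'S_n)))); rewrite mcoeff0 raddf_sum /=.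
rewrite (bigD1 (1%g : 'S_n)) //= big1 ?addr0 => [|s s1].
  by rewrite mcoeffZ mcoeffX eqxx mulr1 odd_perm1 expr0 => /eqP; rewrite oner_eq0.
by rewrite mcoeffZ mcoeffX (inj_eq m_inj) (negbTE s1) mulr0.
Qed.

Lemma Lns0 : Lns p n 0 = Ln p n ^+ p.
Proof.
rewrite /Lns /Ln /moore -(pFrobenius_autE pcharP) -(det_map_mx (pFrobenius_aut pcharP)).
congr (\det _).
by apply/matrixP=> r s; rewrite !mxE /= pFrobenius_autE -exprM -expnSr.
Qed.

Lemma dickson0E : dickson p n 0 = tofrac (Ln p n ^+ p.-1).
Proof.
rewrite -[LHS]/(tofrac (Lns p n 0) / tofrac (Ln p n)) Lns0.
have -> : Ln p n ^+ p = Ln p n ^+ p.-1 * Ln p n.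
  by rewrite -exprSr prednK ?prime_gt0.
rewrite tofracM mulfK //.
by rewrite tofrac_eq0 Ln_neq0.
Qed.

Lemma gl_act_semi g (c f h : P) k :
  gl_act g f = c * f -> gl_act g h = c * h -> c ^+ k.+1 = 1 ->
  gl_act g (f * h ^+ k) = f * h ^+ k.
Proof.
move=> ef eh c1; rewrite gl_actM gl_actX ef eh exprMn mulrACA.
by rewrite -exprS c1 mul1r.
Qed.

Lemma det_fermat (g : 'M['F_p]_n) : g \in unitmx -> \det g ^+ p.-1 = 1.
Proof.
rewrite unitmxE unitfE => d0; apply: (mulfI d0).
by rewrite -exprS prednK ?prime_gt0 // mulr1; apply: (Fp_exp 1).
Qed.

Lemma dickson_alg_Q0 : dickson_alg (Ln p n ^+ p.-1).
Proof.
move=> g ug; rewrite gl_actX gl_act_moore exprMn -rmorphXn /=.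
by rewrite det_fermat // mul1r.
Qed.

Lemma dickson_in_loc (t : int) : dickson_loc (dickson p n t).
Proof.
have L0 : tofrac (Ln p n) != 0 by rewrite tofrac_eq0 Ln_neq0.
case: t => [s|t]; last first.
  by exists 0, 0%N; split=> [g _|]; rewrite ?tofrac0 ?mul0r // /gl_act comp_mpoly0.
have p2 : p.-1 = p.-2.+1 by rewrite prednK // -ltnS prednK ?prime_gt0 ?prime_gt1.
exists (Lns p n s * Ln p n ^+ p.-2), 1%N; split.
  move=> g ug.
  apply: gl_act_semi (gl_act_Lns g s) (gl_act_Ln g) _.
  by rewrite -p2 -rmorphXn /= det_fermat.
rewrite expr1 dickson0E p2 exprSr !tofracM [Y in _ = _ / Y]mulrC -mulf_div.
set u := tofrac (Ln p n ^+ _).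
have u0 : u != 0 by rewrite /u tofracXn expf_neq0.
by rewrite (divff u0) mulr1.
Qed.

Lemma dickson_algM (f h : P) :
  dickson_alg f -> dickson_alg h -> dickson_alg (f * h).
Proof. by move=> Df Dh g ug; rewrite gl_actM Df // Dh. Qed.

Lemma dickson_algX (f : P) k : dickson_alg f -> dickson_alg (f ^+ k).
Proof. by move=> Df g ug; rewrite gl_actX Df. Qed.

(* A derivation along a ring morphism is determined by its values on the      *)
(* variables.                                                                 *)
Lemma der_ext (phi : {rmorphism P -> P}) (d1 d2 : {linear P -> P}) :
    (forall f h, d1 (f * h) = d1 f * phi h + phi f * d1 h) ->
    (forall f h, d2 (f * h) = d2 f * phi h + phi f * d2 h) ->
    (forall r, d1 (X r) = d2 (X r)) ->
  d1 =1 d2.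
Proof.
move=> D1 D2 DX.
have one (d : {linear P -> P}) :
    (forall f h, d (f * h) = d f * phi h + phi f * d h) -> d 1 = 0.
  move=> D; have /eqP := D 1 1.
  by rewrite rmorph1 !mulr1 mul1r -subr_eq subrr eq_sym => /eqP.
elim/mpolyind => [|c m f _ _ IH]; first by rewrite !raddf0.
rewrite !linearD !linearZ /= IH; congr (_ *: _ + _).
rewrite mpolyXE_id.
apply: (big_ind (fun f => d1 f = d2 f)) => [|f1 f2 e1 e2|r _].
- by rewrite !one.
- by rewrite D1 D2 e1 e2.
elim: (m r) => [|k IHk]; first by rewrite !one.
by rewrite exprS D1 D2 DX IHk.
Qed.

Lemma StP_is_linear i : linear (@StP p n i).
Proof.
move=> c f h; rewrite /StP scaler_sumr -big_split /=; apply: eq_bigr => r _.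
by rewrite mderivD mderivZ mulrDr scalerAr.
Qed.

HB.instance Definition _ i :=
  GRing.isLinear.Build 'F_p P P _ (@StP p n i) (StP_is_linear i).

Lemma StPM i (f h : P) : StP i (f * h) = StP i f * h + f * StP i h.
Proof.
rewrite /StP mulr_suml mulr_sumr -big_split /=; apply: eq_bigr => r _.
by rewrite mderivM; ring.
Qed.

Lemma StPXU i (r : 'I_n) : StP i (X r) = X r ^+ (p ^ i).
Proof.
rewrite /StP (bigD1 r) //= mderivX mnmE eqxx scale1r big1 ?addr0 => [|s sr].
  have -> : (U_(r) - U_(r))%MM = 0%MM :> 'X_{1..n}.
    by apply/mnmP=> k; rewrite !mnmE subnn.
  by rewrite mpolyX0 mulr1.
by rewrite mderivX mnmE eq_sym (negbTE sr) scale0r mulr0.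
Qed.

Lemma StPP i (d : {linear P -> P}) :
    (forall f h, d (f * h) = d f * h + f * d h) ->
    (forall r, d (X r) = X r ^+ (p ^ i)) ->
  d =1 StP i.
Proof.
move=> dM dX; apply: (@der_ext idfun d (StP i)) => //; first exact: StPM.
by move=> r; apply: etrans (dX r) _; apply/esym/StPXU.
Qed.

Lemma StP_gl_act i g (f : P) : StP i (gl_act g f) = gl_act g (StP i f).
Proof.
pose G : {lrmorphism P -> P} :=
  comp_mpoly [tuple \sum_(k < n) g r k *: X k | r < n].
apply: (@der_ext G (StP i \o G) (G \o StP i)) => [h k|h k|r] /=.
- by rewrite rmorphM StPM.
- by rewrite StPM rmorphD !rmorphM.
rewrite StPXU rmorphXn /= -!/(gl_act _ _) gl_actXU frob_sum linear_sum.
by apply: eq_bigr => k _; rewrite linearZ /= StPXU exprZn Fp_exp.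
Qed.

Lemma StP_dickson i (f : P) : dickson_alg f -> dickson_alg (StP i f).
Proof. by move=> Df g ug; rewrite -StP_gl_act Df. Qed.

Lemma St_tofrac i (f : P) : St i (tofrac f) = tofrac (StP i f).
Proof. exact: frac_der_tofrac (StPM i) f. Qed.

Lemma St_der i : derivation_on (fun _ => True) (@St p n i).
Proof. by apply: frac_derP; [exact: raddfD | exact: StPM]. Qed.

Lemma dickson_locE (x : {fraction P}) :
  dickson_loc x <->
  exists (f : P) (k : nat), dickson_alg f /\
    x = tofrac f / tofrac (Ln p n ^+ p.-1) ^+ k.
Proof. by rewrite /dickson_loc dickson0E. Qed.

Lemma St_loc i (x : {fraction P}) : dickson_loc x -> dickson_loc (St i x).
Proof.
move=> /dickson_locE [f [k [Df ->]]]; apply/dickson_locE.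
set q := Ln p n ^+ p.-1; have Dq : dickson_alg (q ^+ k).
  exact/dickson_algX/dickson_alg_Q0.
exists (StP i f * q ^+ k - f * StP i (q ^+ k)), (k * 2)%N; split.
  move=> g ug; rewrite [gl_act _ _]raddfB /= -!/(gl_act _ _) !gl_actM.
  by rewrite (Df g ug) (Dq g ug) (StP_dickson i Df ug) (StP_dickson i Dq ug).
rewrite -tofracXn /St (frac_derE (StPM i)) ?expf_neq0 ?Ln_neq0 //.
by rewrite -tofracXn exprM.
Qed.

Lemma St_locP i (d : {fraction P} -> {fraction P}) :
    derivation_on (@dickson_loc p n) d ->
    (forall f : P, dickson_alg f -> d (tofrac f) = tofrac (StP i f)) ->
  forall x, dickson_loc x -> d x = St i x.
Proof.
move=> [_ dM] dE x lx; have [sD sM] := St_der i.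
have [f [k [Df ex]]] := (dickson_locE x).1 lx.
set q := Ln p n ^+ p.-1 in ex.
have Dq : dickson_alg (q ^+ k) by exact/dickson_algX/dickson_alg_Q0.
have q0 : tofrac (q ^+ k) != 0 by rewrite tofrac_eq0 !expf_neq0 ?Ln_neq0.
have lq : dickson_loc (tofrac (q ^+ k)).
  by exists (q ^+ k), 0%N; rewrite expr0 divr1.
have xq : x * tofrac (q ^+ k) = tofrac f by rewrite ex -tofracXn divfK.
apply: (mulIf q0); apply: (addIr (x * tofrac (StP i (q ^+ k)))).
by rewrite -{1}dE // -dM // -St_tofrac -sM // xq dE // St_tofrac.
Qed.

End DicksonFacts.

(* Main.v *)
(* Expanding a Moore determinant with a repeated row gives
   x_r^(p^n) = sum_(s < n) (-1)^(n+s+1) Q_s x_r^(p^s) for every variable x_r.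
   St^{Delta_i} kills p-th powers and sends x_r to x_r^(p^i), so applying it to
   this relation shows that the delta_i(Q_s) are, up to the same signs, the
   coordinates of x_r^(p^i) on x_r, ..., x_r^(p^(n-1)), which are unique because
   the Moore matrix is invertible. Raising to the p-th power and eliminating
   x_r^(p^n) turns the coordinates c_s for i into c_(n-1)^p Q_s - c_(s-1)^p for
   i + 1; two steps from i = n give the formulas for n + 1 and n + 2. Since their
   coefficients are p-th powers, hence constants, iterating is elementary. *)

Require Import Defs.
From mathcomp Require Import all_boot all_order all_algebra.
From mathcomp Require Import perm mpoly ring.

Set Implicit Arguments.
Unset Strict Implicit.
Unset Printing Implicit Defensive.

Import GRing.Theory.
Local Open Scope ring_scope.

(** * Iterates of a derivation on affine expressions with constant coefficients *)

Section Derivation.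
Variables (R : comNzRingType) (d : R -> R).
Hypothesis d_der : derivation_on (fun _ => True) d.

Lemma derivation_onD x y : d (x + y) = d x + d y.
Proof. by case: d_der => dD _; exact: dD. Qed.

Lemma derivation_onM x y : d (x * y) = d x * y + x * d y.
Proof. by case: d_der => _; exact. Qed.

Lemma derivation_on0 : d 0 = 0.
Proof. by apply: (addIr (d 0)); rewrite -derivation_onD !add0r. Qed.

Lemma derivation_on_sum I (r : seq I) (F : I -> R) :
  d (\sum_(i <- r) F i) = \sum_(i <- r) d (F i).
Proof. exact: (big_morph d derivation_onD derivation_on0). Qed.

Lemma derivation_onN x : d (- x) = - d x.
Proof.
by apply: (addIr (d x)); rewrite -derivation_onD !addNr derivation_on0.
Qed.

Lemma derivation_onX x k : d (x ^+ k.+1) = k.+1%:R * x ^+ k * d x.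
Proof.
elim: k => [|k IH]; first by rewrite expr1 expr0; ring.
by rewrite exprS derivation_onM IH -!natr1 exprS; ring.
Qed.

Lemma derivation_on_signM k x : d ((-1) ^+ k * x) = (-1) ^+ k * d x.
Proof.
by rewrite -signr_odd; case: (odd k); rewrite ?mul1r // !mulN1r derivation_onN.
Qed.

Lemma derivation_on_scale c : derivation_on (fun _ => True) (fun x => c * d x).
Proof.
split=> x y _ _; first by rewrite derivation_onD mulrDr.
by rewrite derivation_onM; ring.
Qed.

Lemma derivation_onX_pchar p x : p \in [pchar R] -> d (x ^+ p) = 0.
Proof.
move=> pR; have := pcharf0 pR.
case: p pR => [|q] pR p0; first by move: pR; rewrite inE.
by rewrite derivation_onX p0 !mul0r.
Qed.

Lemma derivation_on1 : d 1 = 0.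
Proof.
by apply: (addIr (d 1)); rewrite add0r -[in RHS](mulr1 1) derivation_onM mulr1 mul1r.
Qed.

Lemma derivation_onX_const b k : d b = 0 -> d (b ^+ k) = 0.
Proof.
by case: k => [|k] db; rewrite ?expr0 ?derivation_on1 // derivation_onX db mulr0.
Qed.

Lemma derivation_on_natM k y : d (k%:R * y) = k%:R * d y.
Proof.
rewrite !mulr_natl; elim: k => [|k IH]; first by rewrite !mulr0n derivation_on0.
by rewrite !mulrS derivation_onD IH.
Qed.

(** As [a] and [b] are constants, [y = a + b * x] satisfies [d y = b * y]; hence the iterates on [x]
    are [y], [b * y], [b ^+ 2 * y] and so on. *)
Lemma iter_derivation_affine a b x m :
  d a = 0 -> d b = 0 -> d x = a + b * x ->
  iter m.+1 d x = b ^+ m.+1 * x + b ^+ m * a.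
Proof.
move=> da db dx; elim: m => [|m IH]; first by rewrite /= dx; ring.
rewrite iterS IH derivation_onD !derivation_onM !derivation_onX_const // da dx.
by rewrite !exprS; ring.
Qed.

(* The factorial appears because each application of [d] also differentiates
   the power of [c], whose logarithmic derivative is [b * c]. *)
Lemma iter_derivation_scaled_affine a b c x m :
  d a = 0 -> d b = 0 -> d c = b * c ^+ 2 -> d x = c * (a + b * x) ->
  iter m.+1 d x = (m.+1)`!%:R * c ^+ m.+1 * (b ^+ m.+1 * x + b ^+ m * a).
Proof.
move=> da db dc dx; elim: m => [|m IH]; first by rewrite /= dx (factS 0) fact0; ring.
rewrite iterS IH -mulrA derivation_on_natM derivation_onM derivation_onX.
rewrite derivation_onD !derivation_onM !derivation_onX_const // da dc dx.
by rewrite (factS m.+1) natrM -[m.+2%:R]natr1 !exprS; ring.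
Qed.

End Derivation.

Lemma sum_ordS_shift (V : nmodType) n (F : nat -> V) : F 0%N = 0 ->
  \sum_(s < n) F s.+1 = \sum_(s < n) F s + F n.
Proof.
by move=> F0; rewrite -(big_ord_recr _ F) big_ord_recl /= F0 add0r.
Qed.

(** * Linear relations with Dickson coefficients among the powers of a variable *)

Section MooreRelations.
Variables (p n : nat).

Local Notation P := {mpoly 'F_p[n]}.
Local Notation var r := ('X_r : P).

(* Expansion of the Moore determinant in which the row of [var r] occurs twice. *)
Lemma Lns_relation (r : 'I_n) :
  \sum_(s < n.+1) (-1) ^+ s * Lns p n s * var r ^+ (p ^ s) = 0.
Proof.
(* Row [0] takes the default [r], and row [k + 1] takes variable [k]; rows [0] and [r + 1] therefore
   agree. *)
pose f (i : 'I_n.+1) : 'I_n := odflt r (unlift ord0 i).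
pose M := \matrix_(i < n.+1, j < n.+1) var (f i) ^+ (p ^ j).
have f0 : f ord0 = r by rewrite /f unlift_none.
have fl k : f (lift ord0 k) = k by rewrite /f liftK.
have M0 : \det M = 0.
  apply: (@determinant_alternate _ _ _ ord0 (lift ord0 r)); first exact: neq_lift.
  by move=> j; rewrite !mxE f0 fl.
rewrite -[RHS]M0 (expand_det_row M ord0); apply: eq_bigr => s _.
rewrite mxE f0 /cofactor add0n mulrC; congr (_ * (_ * \det _)).
by apply/matrixP => i j; rewrite !mxE fl.
Qed.

Lemma Lns_n : Lns p n n = Ln p n.
Proof.
congr (\det _); apply/matrixP => i j.
by rewrite !mxE /bump leqNgt ltn_ord add0n.
Qed.

Hypothesis p_pr : prime p.

Local Notation K := {fraction P}.
Local Notation Q := (dickson p n).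
Local Notation x r := (tofrac (var r) : K).

Lemma pchar_frac_mpoly : p \in [pchar K].
Proof.
apply: (rmorph_pchar (@FracField.tofrac P)); apply: (rmorph_pchar (@mpolyC n 'F_p)).
exact: pchar_Fp.
Qed.

Lemma tofrac_Ln_neq0 : tofrac (Ln p n) != 0.
Proof. by rewrite tofrac_eq0 Ln_neq0. Qed.

Lemma dickson0_neq0 : Q 0 != 0.
Proof. by rewrite dickson0E // tofrac_eq0 expf_neq0 ?Ln_neq0. Qed.

Lemma dickson_relation (r : 'I_n) :
  x r ^+ (p ^ n) = \sum_(s < n) (-1) ^+ (n + s).+1 * Q s * x r ^+ (p ^ s).
Proof.
have := congr1 (fun f => tofrac f / tofrac (Ln p n)) (Lns_relation r).
rewrite tofrac0 mul0r big_ord_recr /= Lns_n tofracD mulrDl.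
rewrite !tofracM tofracXn mulrAC mulfK ?tofrac_Ln_neq0 //.
rewrite rmorph_sum mulr_suml addrC => /eqP; rewrite addr_eq0 => /eqP e.
rewrite rmorphXn rmorphN1 /= in e.
rewrite -[LHS](signrMK n) e mulrN mulr_sumr -sumrN; apply: eq_bigr => s _.
rewrite !tofracM !rmorphXn /= rmorphN1 exprS exprD /=; ring.
Qed.

(** Multiplying the system by the adjugate of the Moore matrix leaves [L_n * a s = 0], and [L_n] is
    nonzero. *)
Lemma moore_free (a : 'I_n -> K) :
  (forall r, \sum_s a s * x r ^+ (p ^ s) = 0) -> forall s, a s = 0.
Proof.
move=> a0 s.
pose M := map_mx (@FracField.tofrac P) (\matrix_(r < n, t < n) var r ^+ (p ^ t)).
have detM : \det M = tofrac (Ln p n) by rewrite det_map_mx.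
have M0 : M *m \col_t a t = 0.
  apply/matrixP => r j; rewrite !mxE -[RHS](a0 r); apply: eq_bigr => t _.
  by rewrite !mxE rmorphXn mulrC.
have := congr1 (mulmx (\adj M)) M0; rewrite mulmxA mul_adj_mx mulmx0 detM.
move/matrixP/(_ s 0); rewrite mul_scalar_mx !mxE => /eqP.
by rewrite mulf_eq0 (negbTE tofrac_Ln_neq0) => /eqP.
Qed.

(** * Frobenius acting on signed coordinates *)

Hypothesis p_odd : odd p.

Lemma signrX_odd k : ((-1) ^+ k : K) ^+ p = (-1) ^+ k.
Proof. by rewrite exprAC -(signr_odd _ p) p_odd expr1. Qed.

Lemma FrobB (a b : K) : (a - b) ^+ p = a ^+ p - b ^+ p.
Proof. by rewrite -!(pFrobenius_autE pchar_frac_mpoly) rmorphB. Qed.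

(* [c s] are the signed coordinates of the [p ^ i]-th powers of the variables
   in the basis of their [p ^ s]-th powers, [0 <= s < n]. *)
Definition moore_coords i (c : int -> K) :=
  forall r : 'I_n,
    x r ^+ (p ^ i) = \sum_(s < n) (-1) ^+ (n + s).+1 * c s * x r ^+ (p ^ s).

Lemma moore_coordsS i c : (0 < n)%N -> c (-1) = 0 -> moore_coords i c ->
  moore_coords i.+1
    (fun s => c (n%:Z - 1) ^+ p * Q s - c (s - 1) ^+ p).
Proof.
move=> n_gt0 c_1 ci r.
(* Frobenius turns the term of index [s] into [G s.+1]. After the shift, [G 0] vanishes because
   [c (-1) = 0], while the overflow term [G n] has sign [+1] and is reduced by
   [dickson_relation]. *)
pose G (s : nat) := (-1) ^+ (n + s) * c (s%:Z - 1) ^+ p * x r ^+ (p ^ s).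
have Gn : G n = c (n%:Z - 1) ^+ p * x r ^+ (p ^ n).
  by rewrite /G addnn -signr_odd odd_double expr0 mul1r.
rewrite expnSr exprM ci -(pFrobenius_autE pchar_frac_mpoly) rmorph_sum /=.
under eq_bigr do rewrite pFrobenius_autE !exprMn signrX_odd -exprM -expnSr.
transitivity (\sum_(s < n) G s.+1).
  by apply: eq_bigr => s _; rewrite /G addnS intS [1 + _]addrC addrK.
rewrite sum_ordS_shift; last first.
  by rewrite /G add0r c_1 expr0n gtn_eqF ?prime_gt0 // mulr0 mul0r.
rewrite Gn dickson_relation mulr_sumr -big_split /=; apply: eq_bigr => s _.
by rewrite /G exprS; ring.
Qed.

(** * First-order action on the Dickson invariants *)

Lemma St_X i k (r : 'I_n) :
  St i (x r ^+ (p ^ k)) = if k == 0%N then x r ^+ (p ^ i) else 0.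
Proof.
case: k => [|k].
  by rewrite expn0 expr1 /= St_tofrac StPXU rmorphXn.
by rewrite expnSr exprM (derivation_onX_pchar (St_der p n i) _ pchar_frac_mpoly).
Qed.

Lemma St_dickson i c : (0 < n)%N -> moore_coords i c ->
  forall s : nat, (s < n)%N -> St i (Q s) = (-1) ^+ n * Q 0 * c s.
Proof.
move=> n_gt0 ci s s_n; have dSt := St_der p n i.
(* The signed error of the claimed formula; by freeness it suffices that these errors satisfy a
   Moore relation. *)
pose a (t : 'I_n) : K := (-1) ^+ (n + t).+1 * (St i (Q t) - (-1) ^+ n * Q 0 * c t).
suff /(_ (Ordinal s_n))/eqP : forall t, a t = 0.
  by rewrite /a mulf_eq0 signr_eq0 subr_eq0 /= => /eqP.
apply: moore_free => r.
(* Only the term [s = 0] survives, all other powers being [p]-th powers. *)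
have x0 : \sum_(s < n) (-1) ^+ (n + s).+1 * Q s * St i (x r ^+ (p ^ s)) =
    - ((-1) ^+ n * Q 0 * x r ^+ (p ^ i)).
  rewrite (bigD1 (Ordinal n_gt0)) //= big1 => [|t t0].
    by rewrite (St_X i 0) addn0 exprS /=; ring.
  by case: t t0 => -[|t] t_n // _; rewrite (St_X i t.+1) mulr0.
(* Since [n > 0], the left side of [dickson_relation] is a [p]-th power and is killed. *)
transitivity (St i (x r ^+ (p ^ n))); last by rewrite St_X gtn_eqF.
rewrite dickson_relation (derivation_on_sum dSt).
under [RHS]eq_bigr do
  rewrite (derivation_onM dSt) (derivation_on_signM dSt).
rewrite big_split /= x0 ci mulr_sumr -sumrB; apply: eq_bigr => t _.
by rewrite /a; ring.
Qed.

Lemma delta_dickson i c : (0 < n)%N -> moore_coords i c ->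
  forall s : nat, (s < n)%N -> delta i (Q s) = c s.
Proof.
move=> n_gt0 ci s s_n; rewrite /delta (St_dickson n_gt0 ci) //.
by rewrite mulrA mulrACA -expr2 sqrr_sign mul1r mulVf ?mul1r ?dickson0_neq0.
Qed.

Lemma delta_derivation i : derivation_on (fun _ => True) (@delta p n i).
Proof. exact: (derivation_on_scale (St_der p n i) ((-1) ^+ n * (Q 0)^-1)). Qed.

Lemma moore_coords_n : moore_coords n Q.
Proof. exact: dickson_relation. Qed.

Lemma moore_coords_n1 : (0 < n)%N ->
  moore_coords n.+1 (fun s => Q (n%:Z - 1) ^+ p * Q s - Q (s - 1) ^+ p).
Proof. by move=> n_gt0; apply: moore_coordsS => //; exact: moore_coords_n. Qed.

(** Both coefficients are kept as explicit [p]-th powers, the form in which they are visibly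
    constants. *)
Lemma moore_coords_n2 : (0 < n)%N ->
  moore_coords n.+2
    (fun s => (Q (n%:Z - 1) ^+ (p + 1) - Q (n%:Z - 2) ^+ p) ^+ p * Q s
              - (Q (n%:Z - 1) ^+ p * Q (s - 1) - Q (s - 2) ^+ p) ^+ p).
Proof.
move=> n_gt0 r; have sub2 (z : int) : z - 2 = z - 1 - 1 by rewrite -addrA -opprD.
have := moore_coordsS n_gt0 _ (moore_coords_n1 n_gt0) r.
rewrite mulr0 expr0n gtn_eqF ?prime_gt0 // subrr => /(_ erefl) ->.
by apply: eq_bigr => s _; rewrite addn1 (exprSr _ p) !sub2.
Qed.

(** * Iterates when the coordinates are affine in [Q s] with [p]-th power coefficients *)

Section Iterates.
Variables (i : nat) (beta : K) (alpha : int -> K).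
Hypotheses (n_gt0 : (0 < n)%N) (alpha0 : alpha 0 = 0).
Hypothesis coords : moore_coords i (fun s => beta ^+ p * Q s - alpha s ^+ p).

Lemma iter_delta_dickson (s m : nat) : (s < n)%N ->
  iter m.+1 (delta i) (Q s) =
    (beta ^+ p) ^+ m.+1 * Q s - (beta ^+ p) ^+ m * alpha s ^+ p.
Proof.
move=> s_n; have d_der := delta_derivation i.
have dX y := derivation_onX_pchar d_der y pchar_frac_mpoly.
rewrite (iter_derivation_affine d_der (a := - alpha s ^+ p) (b := beta ^+ p)) //.
- by rewrite mulrN.
- by rewrite (derivation_onN d_der) dX oppr0.
- exact: dX.
- by rewrite (delta_dickson n_gt0 coords) // addrC.
Qed.

Lemma iter_St_dickson (s m : nat) : (s < n)%N ->
  iter m.+1 (St i) (Q s) = (-1) ^+ (m.+1 * n) * (m.+1)`!%:R * Q 0 ^+ m.+1 *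
    ((beta ^+ p) ^+ m.+1 * Q s - (beta ^+ p) ^+ m * alpha s ^+ p).
Proof.
move=> s_n; have d_der := St_der p n i.
have dX y := derivation_onX_pchar d_der y pchar_frac_mpoly.
pose c := (-1) ^+ n * Q 0.
have cX : c ^+ m.+1 = (-1) ^+ (m.+1 * n) * Q 0 ^+ m.+1.
  by rewrite exprMn -exprM mulnC.
rewrite (iter_derivation_scaled_affine d_der
  (a := - alpha s ^+ p) (b := beta ^+ p) (c := c)) //.
- by rewrite mulrN cX mulrCA mulrA.
- by rewrite (derivation_onN d_der) dX oppr0.
- exact: dX.
(* Here [alpha 0 = 0] removes the constant term, so [c] satisfies [d c = b * c ^ 2]. *)
- have dQ0 : St i (Q 0) = (-1) ^+ n * Q 0 * (beta ^+ p * Q 0).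
    by rewrite (St_dickson n_gt0 coords n_gt0) alpha0 expr0n gtn_eqF ?prime_gt0 // subr0.
  by rewrite /c (derivation_on_signM d_der) dQ0; ring.
- by rewrite (St_dickson n_gt0 coords) // addrC.
Qed.

(** The factor [m!] of the closed formula is divisible by [p]. *)
Lemma iter_St_dickson_eq0 (s m : nat) : (p <= m)%N -> (s < n)%N ->
  iter m (St i) (Q s) = 0.
Proof.
move=> p_m s_n; case: m p_m => [|m] p_m; first by move: p_m; rewrite leqNgt prime_gt0.
have /eqP m0 : (m.+1)`!%:R == 0 :> K.
  by rewrite -(dvdn_pcharf pchar_frac_mpoly) dvdn_fact // prime_gt0.
by rewrite iter_St_dickson // m0 mulr0 !mul0r.
Qed.

End Iterates.

End MooreRelations.

Theorem proposition4p6 (p n : nat) (p_prime : prime p) (p_odd : odd p)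
    (n_gt0 : (0 < n)%N) :
  let Q : int -> {fraction {mpoly 'F_p[n]}} := dickson p n in
  let A (s : nat) := Q (s%:Z - 2) ^+ (p ^ 2)
                     - Q (s%:Z - 1) ^+ p * Q (n%:Z - 1) ^+ (p ^ 2) in
  let B := Q (n%:Z - 1) ^+ (p ^ 2 + p) - Q (n%:Z - 2) ^+ (p ^ 2) in
  (* (1) *)
  (forall s : nat, (s < n)%N ->
     delta n.+1 (Q s%:Z)
       = Q (n%:Z - 1) ^+ p * Q s%:Z - Q (s%:Z - 1) ^+ p
     /\ (forall m : nat, (1 <= m)%N ->
          iter m (delta n.+1) (Q s%:Z)
            = Q (n%:Z - 1) ^+ (m * p) * Q s%:Z
              - Q (n%:Z - 1) ^+ ((m - 1) * p) * Q (s%:Z - 1) ^+ p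
          /\ iter m (St n.+1) (Q s%:Z)
            = (-1) ^+ (m * n) * m`!%:R * Q 0 ^+ m
              * (Q (n%:Z - 1) ^+ (m * p) * Q s%:Z
                 - Q (n%:Z - 1) ^+ ((m - 1) * p) * Q (s%:Z - 1) ^+ p))) /\
  (* (2) *)
  (B = (Q (n%:Z - 1) ^+ (p + 1) - Q (n%:Z - 2) ^+ p) ^+ p /\
   forall s : nat, (s < n)%N ->
     A s = (Q (s%:Z - 2) ^+ p - Q (s%:Z - 1) * Q (n%:Z - 1) ^+ p) ^+ p
     /\ delta n.+2 (Q s%:Z) = A s + B * Q s%:Z
     /\ (forall m : nat, (1 <= m)%N ->
          iter m (delta n.+2) (Q s%:Z)
            = B ^+ m * Q s%:Z + B ^+ (m - 1) * A s
          /\ iter m (St n.+2) (Q s%:Z)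
            = (-1) ^+ (m * n) * m`!%:R * Q 0 ^+ m
              * (B ^+ m * Q s%:Z + B ^+ (m - 1) * A s))) /\
  (* (3) *)
  (forall i : nat, i = n.+1 \/ i = n.+2 ->
     forall m s : nat, (p <= m)%N -> (s < n)%N -> iter m (St i) (Q s%:Z) = 0).

Proof.
move=> Q A B.
have p0 : (0 < p)%N by exact: prime_gt0.
have FB := FrobB p_prime.
have c1 := moore_coords_n1 p_prime p_odd n_gt0.
have c2 := moore_coords_n2 p_prime p_odd n_gt0.
(* [z1] and [z2] are the condition [alpha 0 = 0] for [n + 1] and [n + 2]; both rest on [Q] vanishing
   at negative indices. *)
have z1 : Q (0 - 1) = 0 by [].
have z2 : Q (n%:Z - 1) ^+ p * Q (0 - 1) - Q (0 - 2) ^+ p = 0.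
  by rewrite mulr0 expr0n gtn_eqF // subrr.
have BE : B = (Q (n%:Z - 1) ^+ (p + 1) - Q (n%:Z - 2) ^+ p) ^+ p.
  by rewrite FB -!exprM mulnDl mul1n.
(* [A s] is minus the [p]-th power of [alpha s], which matches the subtraction in the
   coordinates. *)
have AE (s : nat) : A s =
    - (Q (n%:Z - 1) ^+ p * Q (s%:Z - 1) - Q (s%:Z - 2) ^+ p) ^+ p.
  by rewrite FB exprMn -!exprM opprB [X in _ - X]mulrC.
have QX k : Q (n%:Z - 1) ^+ (k * p) = (Q (n%:Z - 1) ^+ p) ^+ k.
  by rewrite mulnC exprM.
split=> [s s_n|]; last split; [|split=> // s s_n|].
- split; first exact: (delta_dickson p_prime n_gt0 c1 s_n).
  case=> [//|m] _; rewrite subn1 /= !QX -!iterS; split.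
    exact: (iter_delta_dickson p_prime n_gt0 c1).
  exact: (iter_St_dickson p_prime n_gt0 z1 c1).
- split; first by rewrite FB exprMn -!exprM.
  split; first by rewrite (delta_dickson p_prime n_gt0 c2 s_n) addrC AE BE.
  case=> [//|m] _; rewrite subn1 /= -!iterS AE BE !mulrN; split.
    exact: (iter_delta_dickson p_prime n_gt0 c2).
  exact: (iter_St_dickson p_prime n_gt0 z2 c2).
- move=> i [] -> m s p_m s_n.
    exact: (iter_St_dickson_eq0 p_prime n_gt0 z1 c1).
  exact: (iter_St_dickson_eq0 p_prime n_gt0 z2 c2).
Qed.
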